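(* Let $k,p,a$ be positive real numbers and $x\in\mathbb{C}\setminus k\mathbb{Z}^{-}$ with $\mathrm{Re}(x)>0$. Then $${}_{p}\Gamma_{k}(x)=a^{\frac{x}{k}}\int_{0}^{\infty}e^{-\frac{t^{k}}{p}a}\,t^{x-1}\,dt.$$
   Context: $\mathbb{Z}^-$ is the set of negative integers. The p-k Pochhammer symbol is ${}_{p}(x)_{n,k}=\left(\frac{xp}{k}\right)\left(\frac{xp}{k}+p\right)\cdots\left(\frac{xp}{k}+(n-1)p\right)$, and the p-k Gamma function is, for $\mathrm{Re}(x)>0$, $${}_{p}\Gamma_{k}(x)=\frac1k\lim_{n\to\infty}\frac{n!\,p^{n+1}(np)^{x/k}}{{}_{p}(x)_{n+1,k}}=\frac1k\lim_{n\to\infty}\frac{n!\,p^{n+1}(np)^{\frac{x}{k}-1}}{{}_{p}(x)_{n,k}}.$$ For a positive real base $c$, $c^{z}=e^{z\ln c}$. *)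

(* Defs.v *)
From Stdlib Require Import Reals Factorial.
From Coquelicot Require Import Coquelicot.
Open Scope R_scope.

Definition Cexp (z : C) : C :=
  (exp (fst z) * cos (snd z), exp (fst z) * sin (snd z)).

(* c ^ z for a real base c > 0.  For c <= 0 the value is meaningless, since
   Stdlib's [ln] returns 0 there. *)
Definition RCpower (c : R) (z : C) : C := Cexp (z * RtoC (ln c))%C.

(* (xp/k) (xp/k + p) ... (xp/k + (n-1)p), with n factors *)
Fixpoint pk_poch (p k : R) (x : C) (n : nat) : C :=
  match n with
  | O => RtoC 1
  | S m => (pk_poch p k x m * (x * RtoC p / RtoC k + RtoC (INR m * p)))%C
  end.

Definition pk_Gamma_seq1 (p k : R) (x : C) (n : nat) : C :=
  (RtoC (INR (Factorial.fact n) * p ^ (n + 1)) * RCpower (INR n * p) (x / RtoC k)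
   / pk_poch p k x (n + 1))%C.

Definition pk_Gamma_seq2 (p k : R) (x : C) (n : nat) : C :=
  (RtoC (INR (Factorial.fact n) * p ^ (n + 1)) * RCpower (INR n * p) (x / RtoC k - RtoC 1)
   / pk_poch p k x n)%C.

(* Both limit expressions exist, agree, and 1/k times their value is g. *)
Definition is_pk_Gamma (p k : R) (x g : C) : Prop :=
  exists L : C,
    filterlim (pk_Gamma_seq1 p k x) eventually (locally L) /\
    filterlim (pk_Gamma_seq2 p k x) eventually (locally L) /\
    g = (RtoC (1 / k) * L)%C.

(* As with [RInt_gen], the value is only meaningful when [is_pk_Gamma p k x]
   holds of some complex number. *)
Definition pk_Gamma (p k : R) (x : C) : C :=
  @iota C_R_CompleteNormedModule (is_pk_Gamma p k x).

(* Improper Riemann integral over (0, +oo): f may be singular at 0, and its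
   values at t <= 0 play no role. *)
Definition ex_CRInt_0_infty (f : R -> C) : Prop :=
  @ex_RInt_gen C_R_CompleteNormedModule f (at_right 0) (Rbar_locally p_infty).

Definition CRInt_0_infty (f : R -> C) : C :=
  @RInt_gen C_R_CompleteNormedModule f (at_right 0) (Rbar_locally p_infty).

(* Main.v *)
(** With [z = x/k] and [c = a/p], the substitution [u = ln c + k ln t] turns the
    integral of the theorem into [c^(-z)/k] times the integral of
    [e^(-e^u) e^(zu)] over the real line, that is, into the Gamma integral.  On
    [u <= ln n] the kernel [e^(-e^u)] is compared with [(1 - e^u/n)^n]: for
    [0 <= s <= n] one has [|e^(-s) - (1 - s/n)^n| <= s^2 e^(-s) / n], so the two
    integrals differ by [O(1/n)].  Repeated integration by parts evaluates the
    second one as Euler's product [n^z n! / (z (z+1) ... (z+n))], which is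
    [p^(-z)] times the term of the sequence defining the p-k Gamma function. *)
Require Import Defs.
From Stdlib Require Import Reals Lra Lia.
From Coquelicot Require Import Coquelicot.
Open Scope R_scope.

(** * Complex-valued functions of a real variable *)

(** Derivatives and integrals are taken in the real normed module R x R; this lemma and the next one
    translate its scaling and norm into [Cmult] and [Cmod]. *)
Lemma scal_C (r : R) (z : C) : @scal R_AbsRing C_R_ModuleSpace r z = (RtoC r * z)%C.
Proof.
  destruct z as [u v]; unfold scal; simpl; unfold prod_scal, Cmult, RtoC, scal; simpl.
  unfold mult; simpl; f_equal; ring.
Qed.

Lemma norm_C (z : C) : @norm R_AbsRing C_R_NormedModule z = Cmod z.
Proof.
  unfold norm, Cmod; simpl; unfold prod_norm, norm; simpl; unfold abs; simpl.
  f_equal; rewrite !Rmult_1_r; f_equal; rewrite <- Rabs_mult; apply Rabs_pos_eq; nra.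
Qed.

(** By linearity: f is the combination of the constant vectors (1, 0) and (0, 1) with its two real
    components as coefficients. *)
Lemma is_derive_C (f : R -> C) (t : R) (l1 l2 : R) :
  is_derive (fun u => fst (f u)) t l1 -> is_derive (fun u => snd (f u)) t l2 ->
  @is_derive R_AbsRing C_R_NormedModule f t (l1, l2).
Proof.
  intros H1 H2.
  apply (is_derive_ext (fun u => plus (scal (fst (f u)) ((1, 0) : C_R_NormedModule))
     (scal (snd (f u)) ((0, 1) : C_R_NormedModule)))).
  - intros u; rewrite !scal_C; destruct (f u) as [a b]; unfold plus; simpl.
    unfold prod_plus, plus, Cmult, RtoC; simpl; f_equal; ring.
  - replace (l1, l2) with (plus (scal l1 ((1, 0) : C_R_NormedModule))
     (scal l2 ((0, 1) : C_R_NormedModule))).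
    + apply (@is_derive_plus R_AbsRing C_R_NormedModule);
        apply (@is_derive_scal_l R_AbsRing C_R_NormedModule); assumption.
    + rewrite !scal_C; unfold plus; simpl.
      unfold prod_plus, plus, Cmult, RtoC; simpl; f_equal; ring.
Qed.

(** * The complex exponential along a line *)

Lemma Cexp_add (u v : C) : Cexp (u + v) = (Cexp u * Cexp v)%C.
Proof.
  destruct u as [a b], v as [c d]; unfold Cexp, Cplus, Cmult; simpl.
  rewrite exp_plus, cos_plus, sin_plus; f_equal; ring.
Qed.

Lemma Cexp_0 : Cexp (RtoC 0) = RtoC 1.
Proof. unfold Cexp, RtoC; simpl; rewrite exp_0, cos_0, sin_0; f_equal; ring. Qed.

Lemma Cexp_real (r : R) : Cexp (RtoC r) = RtoC (exp r).
Proof. unfold Cexp, RtoC; simpl; rewrite cos_0, sin_0; f_equal; ring. Qed.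

Lemma Cmod_Cexp (z : C) : Cmod (Cexp z) = exp (Re z).
Proof.
  destruct z as [a b]; unfold Cmod, Cexp; simpl.
  replace (exp a * cos b * (exp a * cos b * 1) + exp a * sin b * (exp a * sin b * 1))
    with ((exp a)² * ((sin b)² + (cos b)²)) by (unfold Rsqr; ring).
  rewrite sin2_cos2, Rmult_1_r; apply sqrt_Rsqr; left; apply exp_pos.
Qed.

Lemma Re_mult_RtoC (z : C) (u : R) : Re (z * RtoC u) = Re z * u.
Proof. destruct z; unfold Re, RtoC; simpl; ring. Qed.

Lemma is_derive_Cexp_line (z : C) (u : R) :
  @is_derive R_AbsRing C_R_NormedModule (fun t => Cexp (z * RtoC t)) u
    (z * Cexp (z * RtoC u))%C.
Proof.
  destruct z as [a b].
  replace ((a, b) * Cexp ((a, b) * RtoC u))%C with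
    (exp (a * u) * (a * cos (b * u) - b * sin (b * u)),
     exp (a * u) * (a * sin (b * u) + b * cos (b * u))).
  - apply is_derive_C; unfold Cexp, RtoC; simpl; auto_derive; auto;
      replace (a * u - b * 0) with (a * u) by ring;
      replace (a * 0 + b * u) with (b * u) by ring;
      replace (a * u + - (b * 0)) with (a * u) by ring; ring.
  - unfold Cexp, RtoC, Cmult; simpl.
    replace (a * u - b * 0) with (a * u) by ring.
    replace (a * 0 + b * u) with (b * u) by ring.
    f_equal; ring.
Qed.

Lemma continuous_real_mul_Cexp_line (g : R -> R) (z : C) (u : R) : continuous g u ->
  @continuous R_UniformSpace C_R_NormedModule (fun t => RtoC (g t) * Cexp (z * RtoC t))%C u.
Proof.
  intros Hg.
  apply continuous_ext with
    (fun t => @scal R_AbsRing C_R_NormedModule (g t) (Cexp (z * RtoC t))).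
  - intros t; apply scal_C.
  - apply (@continuous_scal R_UniformSpace R_AbsRing C_R_NormedModule); [exact Hg|].
    apply (@ex_derive_continuous R_AbsRing C_R_NormedModule).
    eexists; apply is_derive_Cexp_line.
Qed.

(** Neighbourhoods in C come from the product uniform structure. A disc lies in the ball of the same
    radius, and a ball of radius d lies in the disc of radius sqrt 2 * d. *)
Lemma filterlim_Cmod {T : Type} (F : (T -> Prop) -> Prop) {FF : Filter F} (f : T -> C) (l : C) :
  filterlim f F (locally l) <-> forall eps, 0 < eps -> F (fun t => Cmod (f t - l) < eps).
Proof.
  split.
  - intros H eps He.
    assert (H2 : 0 < sqrt 2) by (apply sqrt_lt_R0; lra).
    assert (Hd : 0 < eps / sqrt 2) by (apply Rdiv_lt_0_compat; assumption).
    apply (filter_imp (fun t => @ball C_UniformSpace l (mkposreal _ Hd) (f t))).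
    + intros t Ht; apply C_NormedModule_mixin_compat2 in Ht; simpl in Ht.
      replace (sqrt 2 * (eps / sqrt 2)) with eps in Ht by (field; lra); exact Ht.
    + apply H; exists (mkposreal _ Hd); intros y Hy; exact Hy.
  - intros H P [d Hd]; unfold filtermap.
    apply (filter_imp (fun t => Cmod (f t - l) < d)).
    + intros t Ht; apply Hd; apply C_NormedModule_mixin_compat1; exact Ht.
    + apply H; apply cond_pos.
Qed.

Lemma filterlim_Cmult {T : Type} (F : (T -> Prop) -> Prop) {FF : Filter F}
    (f g : T -> C) (l m : C) :
  filterlim f F (locally l) -> filterlim g F (locally m) ->
  filterlim (fun t => (f t * g t)%C) F (locally (l * m)%C).
Proof.
  intros Hf Hg; apply filterlim_Cmod; [exact FF|]; intros eps He.
  generalize (Cmod_ge_0 l) (Cmod_ge_0 m); intros Pl Pm.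
  (* With |f - l| < 1 and both errors below d, the three terms of the expansion add up to at most (1
     + |l| + |m|) d; the constant 2 makes this strictly less than eps. *)
  assert (Hd : 0 < eps / (2 + Cmod l + Cmod m)) by (apply Rdiv_lt_0_compat; lra).
  assert (Hde : eps / (2 + Cmod l + Cmod m) * (2 + Cmod l + Cmod m) = eps) by (field; lra).
  generalize (proj1 (filterlim_Cmod F f l) Hf 1 Rlt_0_1)
    (proj1 (filterlim_Cmod F f l) Hf _ Hd) (proj1 (filterlim_Cmod F g m) Hg _ Hd).
  set (d := eps / (2 + Cmod l + Cmod m)) in *.
  intros A B D; generalize (filter_and _ _ A (filter_and _ _ B D)); apply filter_imp.
  intros t [H1 [H2 H3]].
  replace (f t * g t - l * m)%C
    with ((f t - l) * (g t - m) + (l * (g t - m) + (f t - l) * m))%C by ring.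
  eapply Rle_lt_trans; [apply Cmod_triangle|].
  eapply Rle_lt_trans; [apply Rplus_le_compat_l, Cmod_triangle|].
  rewrite !Cmod_mult.
  generalize (Cmod_ge_0 (f t - l)) (Cmod_ge_0 (g t - m)); intros P1 P2.
  nra.
Qed.

Lemma filterlim_Cminus {T : Type} (F : (T -> Prop) -> Prop) {FF : Filter F}
    (f g : T -> C) (l m : C) :
  filterlim f F (locally l) -> filterlim g F (locally m) ->
  filterlim (fun t => (f t - g t)%C) F (locally (l - m)%C).
Proof.
  intros Hf Hg; apply filterlim_Cmod; [exact FF|]; intros eps He.
  generalize (proj1 (filterlim_Cmod F f l) Hf (eps / 2) ltac:(lra))
    (proj1 (filterlim_Cmod F g m) Hg (eps / 2) ltac:(lra)).
  intros A B; generalize (filter_and _ _ A B); apply filter_imp; intros t [H1 H2].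
  replace (f t - g t - (l - m))%C with ((f t - l) + - (g t - m))%C by ring.
  eapply Rle_lt_trans; [apply Cmod_triangle|]; rewrite Cmod_opp; lra.
Qed.

(** * Integrals dominated by a derivative *)

Lemma Cmod_RInt_le (f : R -> C) (g G : R -> R) (a b : R) (l : C) :
  a <= b -> (forall u, a <= u <= b -> Cmod (f u) <= g u) ->
  (forall u, is_derive G u (g u)) -> (forall u, continuous g u) ->
  @is_RInt C_R_NormedModule f a b l -> Cmod l <= G b - G a.
Proof.
  intros Hab Hle HG Hg Hf; rewrite <- norm_C.
  apply (norm_RInt_le f g a b l (G b - G a) Hab); [|exact Hf|].
  - intros u Hu; rewrite norm_C; auto.
  - apply (is_RInt_derive G g); auto.
Qed.

(** Cauchy criterion: integrals over [a, b] and [a', b'] differ by those over [a', a] and [b, b'],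
    which the increments of G bound. These are small because G converges at both ends. *)
Lemma RInt_line_converges (f : R -> C) (g G : R -> R) (lm lp : R) :
  (forall u, @continuous R_UniformSpace C_R_NormedModule f u) ->
  (forall u, Cmod (f u) <= g u) ->
  (forall u, is_derive G u (g u)) -> (forall u, continuous g u) ->
  is_lim G m_infty lm -> is_lim G p_infty lp ->
  exists I : C, filterlim (fun ab => @RInt C_R_CompleteNormedModule f (fst ab) (snd ab))
    (filter_prod (Rbar_locally m_infty) (Rbar_locally p_infty)) (locally I).
Proof.
  intros Hf Hle HG Hg Hm Hp.
  assert (Hex : forall a b, @ex_RInt C_R_CompleteNormedModule f a b)
    by (intros a b; apply (@ex_RInt_continuous C_R_CompleteNormedModule); auto).
  (* The absolute value covers endpoints in either order, since nothing orders a and a', or b and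
     b'. *)
  assert (Hb : forall a b, Cmod (@RInt C_R_CompleteNormedModule f a b) <= Rabs (G b - G a)).
  { assert (Hb0 : forall a b, a <= b ->
      Cmod (@RInt C_R_CompleteNormedModule f a b) <= Rabs (G b - G a)).
    { intros a b Hab; eapply Rle_trans; [|apply Rle_abs].
      apply (Cmod_RInt_le f g G a b); auto.
      apply (@RInt_correct C_R_CompleteNormedModule); auto. }
    intros a b; destruct (Rle_dec a b) as [H|H]; [auto|].
    rewrite <- (@opp_RInt_swap C_R_CompleteNormedModule) by auto.
    rewrite Rabs_minus_sym.
    change (Cmod (- (@RInt C_R_CompleteNormedModule f b a))%C <= Rabs (G a - G b)).
    rewrite Cmod_opp; apply Hb0; lra. }
  apply (proj1 (filterlim_locally_cauchy (U := C_R_CompleteNormedModule) (FF := filter_prod_proper)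
    (fun ab => @RInt C_R_CompleteNormedModule f (fst ab) (snd ab)))).
  intros eps.
  (* Four values of G enter the estimate, one for each endpoint. *)
  assert (He : 0 < eps / 4) by (generalize (cond_pos eps); lra).
  exists (fun ab => Rabs (G (fst ab) - lm) < eps / 4 /\ Rabs (G (snd ab) - lp) < eps / 4).
  split.
  - apply is_lim_spec in Hm; apply is_lim_spec in Hp.
    econstructor; [exact (Hm (mkposreal _ He))|exact (Hp (mkposreal _ He))|].
    intros x y Hx Hy; split; assumption.
  - intros [a b] [a' b'] [H1 H2] [H3 H4]; simpl in *.
    apply C_NormedModule_mixin_compat1.
    change (Cmod (@RInt C_R_CompleteNormedModule f a' b' - @RInt C_R_CompleteNormedModule f a b)%C < eps).
    rewrite <- (@RInt_Chasles C_R_CompleteNormedModule f a' a b') by auto.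
    rewrite <- (@RInt_Chasles C_R_CompleteNormedModule f a b b') by auto.
    change (@plus ?V) with Cplus.
    match goal with |- Cmod (?x + (?y + ?w) - ?y)%C < _ =>
      replace (x + (y + w) - y)%C with (x + w)%C by ring end.
    eapply Rle_lt_trans; [apply Cmod_triangle|].
    generalize (Hb a' a) (Hb b b').
    generalize (Rabs_triang (G a - lm) (lm - G a')) (Rabs_triang (G b' - lp) (lp - G b)).
    rewrite (Rabs_minus_sym lm), (Rabs_minus_sym lp).
    replace (G a - lm + (lm - G a')) with (G a - G a') by ring.
    replace (G b' - lp + (lp - G b)) with (G b' - G b) by ring.
    lra.
Qed.

(** * Euler's product as a Beta integral *)

(** Multiplication by z is real-linear, so the two components of z f are real combinations of those
    of f and are integrated separately. *)
Lemma is_RInt_Cmult_l (z : C) (f : R -> C) (a b : R) (l : C) :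
  @is_RInt C_R_NormedModule f a b l ->
  @is_RInt C_R_NormedModule (fun t => z * f t)%C a b (z * l)%C.
Proof.
  intros H.
  pose proof (is_RInt_fct_extend_fst (U := R_NormedModule) (V := R_NormedModule) f a b l H) as H1.
  pose proof (is_RInt_fct_extend_snd (U := R_NormedModule) (V := R_NormedModule) f a b l H) as H2.
  apply (is_RInt_fct_extend_pair (U := R_NormedModule) (V := R_NormedModule)).
  - apply (is_RInt_minus (V := R_NormedModule)); apply (is_RInt_scal (V := R_NormedModule)); assumption.
  - apply (is_RInt_plus (V := R_NormedModule)); apply (is_RInt_scal (V := R_NormedModule)); assumption.
Qed.

(** The Pochhammer symbol for p = k = 1, to which [pk_poch] reduces once powers of p are factored
    out. *)
Fixpoint rising (z : C) (n : nat) : C :=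
  match n with
  | O => RtoC 1
  | S m => (rising z m * (z + RtoC (INR m)))%C
  end.

(** Splits off the lowest factor instead of the highest, to match the shift from z to z + 1 in the
    integration by parts. *)
Lemma rising_S_l (z : C) (n : nat) : rising z (S n) = (z * rising (z + RtoC 1) n)%C.
Proof.
  induction n as [|n IH]; [simpl; ring|].
  change (rising z (S (S n))) with (rising z (S n) * (z + RtoC (INR (S n))))%C.
  rewrite IH, S_INR, RtoC_plus; simpl; ring.
Qed.

(** Every factor z + m has positive real part. *)
Lemma rising_neq_0 (z : C) (n : nat) : 0 < Re z -> rising z n <> RtoC 0.
Proof.
  intros Hz; induction n as [|n IH]; simpl.
  - intros H; apply (f_equal Re) in H; simpl in H; lra.
  - apply Cmult_neq_0; [exact IH|].
    intros H; apply (f_equal Re) in H; destruct z as [a b]; unfold Re, RtoC in *; simpl in *.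
    generalize (pos_INR n); lra.
Qed.

(** With s = e^v this is the integral of (1 - s)^n s^(z-1) from e^A to 1, a truncation of the Beta
    integral B(z, n+1). *)
Definition beta_int (n : nat) (z : C) (A : R) : C :=
  @RInt C_R_CompleteNormedModule
    (fun v => (RtoC ((1 - exp v) ^ n) * Cexp (z * RtoC v))%C) A 0.

Lemma continuous_pow_1_exp (n : nat) (u : R) : continuous (fun v => (1 - exp v) ^ n) u.
Proof.
  apply (ex_derive_continuous (V := R_NormedModule)); auto_derive; auto.
Qed.

Lemma is_RInt_beta_int (n : nat) (z : C) (A : R) :
  @is_RInt C_R_NormedModule
    (fun v => (RtoC ((1 - exp v) ^ n) * Cexp (z * RtoC v))%C) A 0 (beta_int n z A).
Proof.
  apply (@RInt_correct C_R_CompleteNormedModule).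
  apply (@ex_RInt_continuous C_R_CompleteNormedModule).
  intros u _; apply continuous_real_mul_Cexp_line, continuous_pow_1_exp.
Qed.

(** The derivative of (1 - e^v)^n e^(zv) is integrated from A to 0. For n = 0 the boundary value 0^0
    is 1, and [pred 0] is harmless because its coefficient vanishes. *)
Lemma beta_int_by_parts (n : nat) (z : C) (A : R) :
  (z * beta_int n z A - RtoC (INR n) * beta_int (pred n) (z + RtoC 1) A)%C
  = (RtoC (0 ^ n) - RtoC ((1 - exp A) ^ n) * Cexp (z * RtoC A))%C.
Proof.
  assert (H := @is_RInt_scal_derive C_R_CompleteNormedModule
    (fun v => (1 - exp v) ^ n) (fun v => Cexp (z * RtoC v))
    (fun v => - (INR n * (exp v * (1 - exp v) ^ pred n)))
    (fun v => (z * Cexp (z * RtoC v))%C) A 0).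
  assert (H' := H ltac:(intros; auto_derive; auto; unfold Rminus; ring)
    ltac:(intros; apply is_derive_Cexp_line)
    ltac:(intros; apply (ex_derive_continuous (V := R_NormedModule)); auto_derive; auto)).
  clear H.
  assert (Hc : forall t, Rmin A 0 <= t <= Rmax A 0 ->
    @continuous R_UniformSpace C_R_NormedModule (fun v => (z * Cexp (z * RtoC v))%C) t).
  { intros t _; apply (filterlim_Cmult (locally t)); [apply filterlim_const|].
    apply (@ex_derive_continuous R_AbsRing C_R_NormedModule).
    eexists; apply is_derive_Cexp_line. }
  specialize (H' Hc); clear Hc.
  assert (K : @is_RInt C_R_NormedModule (fun v => (z * (RtoC ((1 - exp v) ^ n) * Cexp (z * RtoC v))
      - RtoC (INR n) * (RtoC ((1 - exp v) ^ pred n) * Cexp ((z + RtoC 1) * RtoC v)))%C) A 0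
     (z * beta_int n z A - RtoC (INR n) * beta_int (pred n) (z + RtoC 1) A)%C).
  { apply (is_RInt_minus (V := C_R_NormedModule)); apply is_RInt_Cmult_l, is_RInt_beta_int. }
  (* Both sides are integrals of the same function, up to the identity e^((z+1)v) = e^(zv) e^v. *)
  apply (@is_RInt_unique C_R_CompleteNormedModule) in K; rewrite <- K; clear K.
  apply (@is_RInt_unique C_R_CompleteNormedModule).
  match type of H' with is_RInt _ _ _ ?l => replace (RtoC (0 ^ n) - RtoC ((1 - exp A) ^ n) * Cexp (z * RtoC A))%C with l end.
  - refine (is_RInt_ext _ _ _ _ _ _ H'); intros v _.
    rewrite !scal_C; change (@plus ?V) with Cplus.
    replace ((z + RtoC 1) * RtoC v)%C with (z * RtoC v + RtoC v)%C by ring.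
    match goal with |- ?l = ?r => change (@eq C l r) end.
    rewrite Cexp_add, Cexp_real, RtoC_opp, !RtoC_mult; ring.
  - rewrite !scal_C, exp_0, Rminus_diag, Cmult_0_r, Cexp_0, Cmult_1_r; reflexivity.
Qed.

(** As A tends to minus infinity the boundary term at A vanishes, leaving B_(n+1)(z) = ((n+1)/z)
    B_n(z+1). The induction therefore keeps z general. *)
Lemma beta_int_lim (n : nat) : forall z, 0 < Re z ->
  filterlim (beta_int n z) (Rbar_locally m_infty)
    (locally (RtoC (INR (Factorial.fact n)) / rising z (S n))%C).
Proof.
  assert (Hbd : forall m z, 0 < Re z ->
    filterlim (fun A => (RtoC ((1 - exp A) ^ m) * Cexp (z * RtoC A))%C)
      (Rbar_locally m_infty) (locally (RtoC 0))).
  { intros m z Hz; apply (filterlim_Cmod (Rbar_locally m_infty)); intros eps He.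
    (* The bound 0 keeps 1 - e^A within [0, 1]; the other bound gives |e^(zA)| = e^(A Re z) <
       eps. *)
    exists (Rmin 0 (ln eps / Re z)); intros A HA.
    assert (H0 : A < 0) by (eapply Rlt_le_trans; [exact HA|apply Rmin_l]).
    assert (H1 : A < ln eps / Re z) by (eapply Rlt_le_trans; [exact HA|apply Rmin_r]).
    unfold Cminus; rewrite Copp_0, Cplus_0_r, Cmod_mult, Cmod_R, Cmod_Cexp, Re_mult_RtoC.
    assert (E : 0 < exp A < 1) by (split; [apply exp_pos|rewrite <- exp_0; apply exp_increasing; lra]).
    rewrite Rabs_pos_eq by (left; apply pow_lt; lra).
    apply Rle_lt_trans with (1 * exp (Re z * A)).
    - apply Rmult_le_compat_r; [left; apply exp_pos|].
      apply Rle_trans with (1 ^ m); [apply pow_incr; lra|rewrite pow1; lra].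
    - rewrite Rmult_1_l, <- (exp_ln eps He); apply exp_increasing.
      apply Rmult_lt_reg_l with (/ Re z); [apply Rinv_0_lt_compat; lra|].
      rewrite <- Rmult_assoc, Rinv_l, Rmult_1_l by lra.
      rewrite Rmult_comm; exact H1. }
  assert (Hz0 : forall z, 0 < Re z -> z <> RtoC 0)
    by (intros z Hz E; rewrite E in Hz; simpl in Hz; lra).
  induction n as [|n IH]; intros z Hz.
  - apply (filterlim_ext (fun A => (/ z * (RtoC 1 - RtoC ((1 - exp A) ^ 0) * Cexp (z * RtoC A)))%C)).
    + intros A; generalize (beta_int_by_parts 0 z A); simpl; intros <-.
      field; auto.
    + replace (RtoC (INR (Factorial.fact 0)) / rising z 1)%C with (/ z * (RtoC 1 - RtoC 0))%C
        by (replace (rising z 1) with z by (simpl; ring); simpl; field; auto).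
      apply (filterlim_Cmult (Rbar_locally m_infty)); [apply filterlim_const|].
      apply (filterlim_Cminus (Rbar_locally m_infty)); [apply filterlim_const|auto].
  - assert (Hz1 : 0 < Re (z + RtoC 1)) by (destruct z; unfold Re, RtoC in *; simpl in *; lra).
    apply (filterlim_ext (fun A => (/ z * (RtoC (INR (S n)) * beta_int n (z + RtoC 1) A
       - RtoC ((1 - exp A) ^ S n) * Cexp (z * RtoC A)))%C)).
    (* Here 0^(n+1) = 0, so the upper boundary term disappears. *)
    + intros A; generalize (beta_int_by_parts (S n) z A); rewrite pow_i by lia.
      change (pred (S n)) with n.
      intros E; transitivity (/ z * (z * beta_int (S n) z A))%C; [|field; auto].
      f_equal; symmetry.
      transitivity ((z * beta_int (S n) z A - RtoC (INR (S n)) * beta_int n (z + 1) A)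
         + RtoC (INR (S n)) * beta_int n (z + 1) A)%C; [ring|rewrite E; ring].
    + replace (RtoC (INR (Factorial.fact (S n))) / rising z (S (S n)))%C with
        (/ z * (RtoC (INR (S n)) * (RtoC (INR (Factorial.fact n)) / rising (z + RtoC 1) (S n)) - RtoC 0))%C.
      * apply (filterlim_Cmult (Rbar_locally m_infty)); [apply filterlim_const|].
        apply (filterlim_Cminus (Rbar_locally m_infty)); [|auto].
        apply (filterlim_Cmult (Rbar_locally m_infty)); [apply filterlim_const|auto].
      * rewrite (rising_S_l z); change (Factorial.fact (S n)) with (S n * Factorial.fact n)%nat.
        rewrite mult_INR, RtoC_mult; field; split; [apply rising_neq_0|]; auto.
Qed.

(** * The Gamma integral on the real line *)

Lemma exp_monotone (u v : R) : u <= v -> exp u <= exp v.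
Proof. intros [H| ->]; [left; apply exp_increasing, H|right; reflexivity]. Qed.

(** For m > 0 the exponent m u - e^u is largest at u = ln m: the tangent inequality e^(u - ln m) >=
    1 + u - ln m gives e^u >= m + m (u - ln m). *)
Lemma exp_mul_le_exp_exp (m : R) : 0 <= m ->
  exists K, forall u, exp (m * u) * exp (- exp u) <= K.
Proof.
  intros [Hm| <-].
  - exists (exp (m * ln m - m)); intros u; rewrite <- exp_plus.
    apply exp_monotone.
    generalize (exp_ineq1_le (u - ln m)); intros H.
    assert (E : exp u = m * exp (u - ln m)).
    { rewrite <- (exp_ln m Hm) at 1; rewrite <- exp_plus; f_equal; ring. }
    rewrite E; nra.
  - exists 1; intros u; rewrite Rmult_0_l, exp_0, Rmult_1_l, <- exp_0.
    apply exp_monotone; generalize (exp_pos u); lra.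
Qed.

(** One majorant serves twice: the summand 1 handles convergence of the Gamma integral, and e^(2u)
    handles the error of Euler's approximation. *)
Lemma gamma_kernel_majorant (s : R) : 0 < s -> exists K, 0 < K /\ forall u,
  (1 + exp u ^ 2) * exp (- exp u) * exp (s * u) <= K * (exp (s * u) / (1 + exp (s * u)) ^ 2).
Proof.
  intros Hs.
  (* The exponents 0, s, 2s, 2, 2 + s, 2 + 2s are those in the expansion of (1 + e^(2u)) (1 +
     e^(su))^2, with coefficients 1, 2, 1, 1, 2, 1. *)
  destruct (exp_mul_le_exp_exp 0) as [K0 H0]; [lra|].
  destruct (exp_mul_le_exp_exp s) as [K1 H1]; [lra|].
  destruct (exp_mul_le_exp_exp (s + s)) as [K2 H2]; [lra|].
  destruct (exp_mul_le_exp_exp (1 + 1)) as [K3 H3]; [lra|].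
  destruct (exp_mul_le_exp_exp (1 + 1 + s)) as [K4 H4]; [lra|].
  destruct (exp_mul_le_exp_exp (1 + 1 + (s + s))) as [K5 H5]; [lra|].
  assert (Hb : forall u, (1 + exp u ^ 2) * (1 + exp (s * u)) ^ 2 * exp (- exp u)
    <= K0 + 2 * K1 + K2 + K3 + 2 * K4 + K5).
  { intros u; specialize (H0 u); specialize (H1 u); specialize (H2 u);
      specialize (H3 u); specialize (H4 u); specialize (H5 u).
    repeat rewrite ?Rmult_plus_distr_r, ?exp_plus, ?Rmult_1_l in H2.
    repeat rewrite ?Rmult_plus_distr_r, ?exp_plus, ?Rmult_1_l in H3.
    repeat rewrite ?Rmult_plus_distr_r, ?exp_plus, ?Rmult_1_l in H4.
    repeat rewrite ?Rmult_plus_distr_r, ?exp_plus, ?Rmult_1_l in H5.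
    rewrite Rmult_0_l, exp_0 in H0; simpl; lra. }
  exists (K0 + 2 * K1 + K2 + K3 + 2 * K4 + K5).
  assert (P : forall u, 0 < (1 + exp (s * u)) ^ 2)
    by (intros u; apply pow_lt; generalize (exp_pos (s * u)); lra).
  split.
  (* The constant is positive because it bounds a positive value, the one at u = 0. *)
  - eapply Rlt_le_trans; [|apply (Hb 0)].
    apply Rmult_lt_0_compat; [apply Rmult_lt_0_compat; [|apply P]|apply exp_pos].
    generalize (pow2_ge_0 (exp 0)); lra.
  - intros u; generalize (P u) (Hb u); intros Pu Hu.
    apply Rmult_le_reg_r with ((1 + exp (s * u)) ^ 2); [exact Pu|].
    replace ((K0 + 2 * K1 + K2 + K3 + 2 * K4 + K5) * (exp (s * u) / (1 + exp (s * u)) ^ 2)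
        * (1 + exp (s * u)) ^ 2) with ((K0 + 2 * K1 + K2 + K3 + 2 * K4 + K5) * exp (s * u))
      by (field; generalize (exp_pos (s * u)); lra).
    generalize (exp_pos (s * u)); intros; nra.
Qed.

(* An antiderivative of [e^(su) / (1 + e^(su))^2], the integrable majorant used
   for all integrals over the line. *)
Definition logistic (s u : R) : R := - / (s * (1 + exp (s * u))).

Lemma is_derive_logistic (s u : R) : 0 < s ->
  is_derive (logistic s) u (exp (s * u) / (1 + exp (s * u)) ^ 2).
Proof.
  intros Hs; generalize (exp_pos (s * u)); intros P; unfold logistic; auto_derive.
  - apply Rgt_not_eq, Rmult_lt_0_compat; lra.
  - field; split; lra.
Qed.

(** All values lie between -1/s and 0. *)
Lemma logistic_bounds (s u v : R) : 0 < s -> logistic s v - logistic s u <= / s.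
Proof.
  intros Hs; unfold logistic; rewrite !Rinv_mult.
  generalize (exp_pos (s * u)) (exp_pos (s * v)); intros Pu Pv.
  assert (Q := Rinv_0_lt_compat _ Hs).
  assert (/ (1 + exp (s * u)) <= 1) by (rewrite <- Rinv_1; apply Rinv_le_contravar; lra).
  assert (0 < / (1 + exp (s * v))) by (apply Rinv_0_lt_compat; lra).
  nra.
Qed.

Lemma logistic_lim_m (s : R) : 0 < s -> is_lim (logistic s) m_infty (- / s).
Proof.
  intros Hs; unfold logistic.
  assert (E : is_lim (fun u => exp (s * u)) m_infty 0).
  { apply (is_lim_comp exp (fun u => s * u) m_infty 0 m_infty).
    - apply is_lim_exp_m.
    - replace m_infty with (Rbar_mult s m_infty) at 2.
      + apply is_lim_scal_l, is_lim_id.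
      + unfold Rbar_mult; simpl; destruct (Rle_dec 0 s) as [H|H]; [|lra].
        destruct (Rle_lt_or_eq_dec 0 s H); [reflexivity|lra].
    - exists 0; intros; discriminate. }
  assert (D : is_lim (fun u => s * (1 + exp (s * u))) m_infty s).
  { replace (Finite s) with (Rbar_mult s (1 + 0)) by (simpl; f_equal; ring).
    apply is_lim_scal_l; apply (is_lim_plus' (fun _ => 1)); [apply is_lim_const|exact E]. }
  apply (is_lim_opp _ _ (/ s)), (is_lim_inv _ _ s D); intros H; injection H; lra.
Qed.

Lemma logistic_lim_p (s : R) : 0 < s -> is_lim (logistic s) p_infty 0.
Proof.
  (* From e^(su) >= 1 + su one gets s (1 + e^(su)) >= s^2 u, which exceeds 1/eps beyond this
     threshold. *)
  intros Hs; apply is_lim_spec; intros eps; exists (/ (s * s * eps)); intros u Hu.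
  generalize (cond_pos eps); intros He.
  assert (Hp : 0 < s * s * eps) by (repeat apply Rmult_lt_0_compat; lra).
  assert (Hu' : 1 < s * s * eps * u).
  { rewrite <- (Rinv_r (s * s * eps)) by lra; apply Rmult_lt_compat_l; assumption. }
  unfold logistic; rewrite Rminus_0_r, Rabs_Ropp.
  generalize (exp_ineq1_le (s * u)); intros Hex.
  assert (D : 0 < s * (1 + exp (s * u))) by (apply Rmult_lt_0_compat; generalize (exp_pos (s * u)); lra).
  rewrite Rabs_pos_eq by (left; apply Rinv_0_lt_compat; exact D).
  apply Rmult_lt_reg_r with (s * (1 + exp (s * u))); [exact D|].
  rewrite Rinv_l by lra.
  apply Rlt_le_trans with (1 := Hu').
  replace (s * s * eps * u) with (eps * (s * (s * u))) by ring.
  apply Rmult_le_compat_l; [lra|]; apply Rmult_le_compat_l; lra.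
Qed.

(** * Comparison of e^(-t) with (1 - t/n)^n *)

Lemma Bernoulli_minus (y : R) (n : nat) : 0 <= y <= 1 -> 1 - INR n * y <= (1 - y) ^ n.
Proof.
  intros Hy; induction n as [|n IH]; [simpl; lra|].
  rewrite S_INR; simpl.
  assert (0 <= INR n) by apply pos_INR.
  apply Rle_trans with ((1 - y) * (1 - INR n * y)); [nra|].
  apply Rmult_le_compat_l; lra.
Qed.

Lemma exp_INR_mul (n : nat) (y : R) : exp (INR n * y) = exp y ^ n.
Proof.
  induction n as [|n IH]; [rewrite Rmult_0_l, exp_0; reflexivity|].
  rewrite S_INR, Rmult_plus_distr_r, exp_plus, IH, Rmult_1_l; simpl; ring.
Qed.

(** Put y = t/n. The inequality 1 - y <= e^(-y) shows that the difference is nonnegative. Conversely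
    e^(-y) (1 + y) <= 1 gives e^(-y) (1 - y^2) <= 1 - y; taking n-th powers and applying Bernoulli's
    inequality to (1 - y^2)^n leaves the relative error n y^2 = t^2/n. *)
Lemma exp_minus_euler_pow (n : nat) (t : R) : (0 < n)%nat -> 0 <= t <= INR n ->
  Rabs (exp (- t) - (1 - t / INR n) ^ n) <= t ^ 2 * exp (- t) / INR n.
Proof.
  intros Hn Ht.
  assert (Pn : 0 < INR n) by (apply lt_0_INR; exact Hn).
  set (y := t / INR n).
  assert (Ey : t = INR n * y) by (unfold y; field; lra).
  assert (Hy : 0 <= y <= 1).
  { rewrite Ey in Ht; split; apply Rmult_le_reg_l with (INR n); lra. }
  assert (Ex : exp (- t) = exp (- y) ^ n).
  { rewrite <- exp_INR_mul; f_equal; rewrite Ey; ring. }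
  assert (U : (1 - y) ^ n <= exp (- t)).
  { rewrite Ex; apply pow_incr; generalize (exp_ineq1_le (- y)); lra. }
  assert (L : exp (- t) * (1 - INR n * y ^ 2) <= (1 - y) ^ n).
  { apply Rle_trans with (exp (- t) * (1 - y ^ 2) ^ n).
    - apply Rmult_le_compat_l; [left; apply exp_pos|].
      apply Bernoulli_minus; nra.
    - rewrite Ex, <- Rpow_mult_distr; apply pow_incr.
      generalize (exp_pos (- y)); intros P.
      split; [apply Rmult_le_pos; nra|].
      assert (Q : exp (- y) * (1 + y) <= 1).
      { generalize (exp_ineq1_le y); intros H.
        replace 1 with (exp (- y) * exp y) at 2
          by (rewrite <- exp_plus; replace (- y + y) with 0 by ring; apply exp_0).
        apply Rmult_le_compat_l; lra. }
      replace (exp (- y) * (1 - y ^ 2)) with (exp (- y) * (1 + y) * (1 - y)) by ring.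
      nra. }
  rewrite Rabs_pos_eq by lra.
  replace (t ^ 2 * exp (- t) / INR n) with (exp (- t) * (INR n * y ^ 2))
    by (rewrite Ey; field; lra).
  lra.
Qed.

(** * The Gamma integral in the variable u = ln s, and Euler's limit *)

Definition gamma_kernel (z : C) (u : R) : C := (RtoC (exp (- exp u)) * Cexp (z * RtoC u))%C.

Lemma continuous_gamma_kernel (z : C) (u : R) :
  @continuous R_UniformSpace C_R_NormedModule (gamma_kernel z) u.
Proof.
  apply continuous_real_mul_Cexp_line, (ex_derive_continuous (V := R_NormedModule)).
  auto_derive; auto.
Qed.

Lemma is_RInt_gamma_kernel (z : C) (a b : R) :
  @is_RInt C_R_NormedModule (gamma_kernel z) a b
    (@RInt C_R_CompleteNormedModule (gamma_kernel z) a b).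
Proof.
  apply (@RInt_correct C_R_CompleteNormedModule), (@ex_RInt_continuous C_R_CompleteNormedModule).
  intros u _; apply continuous_gamma_kernel.
Qed.

Lemma gamma_kernel_converges (z : C) : 0 < Re z ->
  exists I : C, filterlim
    (fun ab => @RInt C_R_CompleteNormedModule (gamma_kernel z) (fst ab) (snd ab))
    (filter_prod (Rbar_locally m_infty) (Rbar_locally p_infty)) (locally I).
Proof.
  intros Hz; destruct (gamma_kernel_majorant (Re z) Hz) as [K [HK Hle]].
  apply RInt_line_converges with
    (g := fun u => K * (exp (Re z * u) / (1 + exp (Re z * u)) ^ 2))
    (G := fun u => K * logistic (Re z) u) (lm := K * - / Re z) (lp := K * 0).
  - apply continuous_gamma_kernel.
  - intros u; eapply Rle_trans; [|apply Hle].
    unfold gamma_kernel; rewrite Cmod_mult, Cmod_R, Cmod_Cexp, Re_mult_RtoC.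
    generalize (exp_pos (- exp u)) (exp_pos (Re z * u)) (pow2_ge_0 (exp u)); intros P Q S.
    rewrite Rabs_pos_eq by lra.
    apply Rmult_le_compat_r; [lra|nra].
  - intros u; apply (is_derive_scal (logistic (Re z))), is_derive_logistic, Hz.
  - intros u; apply (ex_derive_continuous (V := R_NormedModule)).
    generalize (exp_pos (Re z * u)); intros; auto_derive; repeat split; nra.
  - apply (is_lim_scal_l _ K m_infty (- / Re z)), logistic_lim_m, Hz.
  - apply (is_lim_scal_l _ K p_infty 0), logistic_lim_p, Hz.
Qed.

(** The translation v = u - ln n turns e^u/n into e^v, moves the upper endpoint to 0 and produces
    the factor n^z. *)
Lemma is_RInt_euler_pow (n : nat) (z : C) (A : R) : (0 < n)%nat ->
  @is_RInt C_R_NormedModule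
    (fun u => (RtoC ((1 - exp u / INR n) ^ n) * Cexp (z * RtoC u))%C) A (ln (INR n))
    (Cexp (z * RtoC (ln (INR n))) * beta_int n z (A - ln (INR n)))%C.
Proof.
  intros Hn; assert (Pn : 0 < INR n) by (apply lt_0_INR; exact Hn).
  set (h := fun v => (RtoC ((1 - exp v) ^ n) * Cexp (z * RtoC v))%C).
  assert (H : @is_RInt C_R_NormedModule (fun u => h (u - ln (INR n))) A (ln (INR n))
     (beta_int n z (A - ln (INR n)))).
  { unfold beta_int; replace 0 with (ln (INR n) - ln (INR n)) by ring.
    apply (is_RInt_ext (V := C_R_NormedModule)
      (fun u => @scal R_AbsRing C_R_NormedModule 1 (h (u - ln (INR n))))).
    { intros u _; rewrite scal_C; apply Cmult_1_l. }
    apply (@is_RInt_comp C_R_CompleteNormedModule h (fun u => u - ln (INR n)) (fun _ => 1)).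
    - intros u _; apply continuous_real_mul_Cexp_line, continuous_pow_1_exp.
    - intros u _; split; [auto_derive; auto; ring|apply continuous_const]. }
  apply (is_RInt_Cmult_l (Cexp (z * RtoC (ln (INR n))))) in H.
  refine (is_RInt_ext _ _ _ _ _ _ H); intros u _; unfold h.
  match goal with |- ?l = ?r => change (@eq C l r) end.
  replace (z * RtoC u)%C with (z * RtoC (ln (INR n)) + z * RtoC (u - ln (INR n)))%C
    by (rewrite RtoC_minus; ring).
  rewrite Cexp_add; unfold Rminus at 2; rewrite exp_plus, exp_Ropp, exp_ln by exact Pn.
  unfold Rdiv; ring.
Qed.

(** Euler's product for Gamma(z), with n + 1 factors in the denominator. At n = 0 the value
    [ln 0 = 0] makes the power 1, which does not affect the limit. *)
Definition euler_seq (z : C) (n : nat) : C :=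
  (Cexp (z * RtoC (ln (INR n))) * (RtoC (INR (Factorial.fact n)) / rising z (S n)))%C.

(** For large n, with A chosen afterwards, three errors are below eps/3: truncating the Gamma
    integral to [A, ln n], replacing its kernel by Euler's power, and truncating the Beta integral
    at A. *)
Lemma euler_limit (z I : C) : 0 < Re z ->
  filterlim
    (fun ab => @RInt C_R_CompleteNormedModule (gamma_kernel z) (fst ab) (snd ab))
    (filter_prod (Rbar_locally m_infty) (Rbar_locally p_infty)) (locally I) ->
  filterlim (euler_seq z) eventually (locally I).
Proof.
  intros Hz HI; destruct (gamma_kernel_majorant (Re z) Hz) as [K [HK Hle]].
  apply (filterlim_Cmod eventually); intros eps He.
  destruct (proj1 (filterlim_Cmod _ _ _) HI (eps / 3)) as [P Q HP [B HB] HPQ]; [lra|].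
  (* The first bound gives ln n > B, the second K / (n Re z) < eps/3. *)
  set (T := Rmax (exp B) (3 * K / Re z / eps)).
  destruct (INR_unbounded T) as [N HN].
  exists (S N); intros n Hn.
  assert (HnT : T < INR n) by (eapply Rlt_trans; [exact HN|apply lt_INR; lia]).
  assert (Hn0 : (0 < n)%nat) by lia.
  assert (Pn : 0 < INR n) by (apply lt_0_INR; exact Hn0).
  assert (HBn : B < ln (INR n)).
  { rewrite <- (ln_exp B); apply ln_increasing; [apply exp_pos|].
    eapply Rle_lt_trans; [apply Rmax_l|exact HnT]. }
  assert (HKn : K / Re z / INR n < eps / 3).
  { assert (H : 3 * K / Re z / eps < INR n) by (eapply Rle_lt_trans; [apply Rmax_r|exact HnT]).
    apply Rmult_lt_reg_r with (3 * INR n / eps).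
    - apply Rdiv_lt_0_compat; lra.
    - replace (K / Re z / INR n * (3 * INR n / eps)) with (3 * K / Re z / eps) by (field; lra).
      replace (eps / 3 * (3 * INR n / eps)) with (INR n) by (field; lra).
      exact H. }
  assert (Hlim : filterlim (fun A => (Cexp (z * RtoC (ln (INR n))) * beta_int n z (A - ln (INR n)))%C)
     (Rbar_locally m_infty) (locally (euler_seq z n))).
  { apply (filterlim_Cmult (Rbar_locally m_infty)); [apply filterlim_const|].
    apply (filterlim_comp _ _ _ (fun A => A - ln (INR n)) (beta_int n z) _ (Rbar_locally m_infty)).
    - intros S [M HM]; exists (M + ln (INR n)); intros A HA; apply HM; lra.
    - apply beta_int_lim, Hz. }
  assert (HA := proj1 (filterlim_Cmod _ _ _) Hlim (eps / 3) ltac:(lra)).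
  assert (HA0 : Rbar_locally m_infty (fun A => A <= ln (INR n)))
    by (exists (ln (INR n)); intros; lra).
  (* A single A far enough to the left meets both truncation requirements and lies below ln n. *)
  destruct (filter_ex _ (filter_and _ _ HP (filter_and _ _ HA HA0))) as [A [HA1 [HA2 HA3]]].
  specialize (HPQ A (ln (INR n)) HA1 (HB _ HBn)); simpl in HPQ.
  set (J := @RInt C_R_CompleteNormedModule (gamma_kernel z) A (ln (INR n))) in *.
  set (W := (Cexp (z * RtoC (ln (INR n))) * beta_int n z (A - ln (INR n)))%C) in *.
  assert (HD : Cmod (J - W) <= K / Re z / INR n).
  { eapply Rle_trans.
    - apply (Cmod_RInt_le
        (fun u => gamma_kernel z u - RtoC ((1 - exp u / INR n) ^ n) * Cexp (z * RtoC u))%C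
        (fun u => K / INR n * (exp (Re z * u) / (1 + exp (Re z * u)) ^ 2))
        (fun u => K / INR n * logistic (Re z) u) A (ln (INR n)) (J - W)%C HA3).
      4: apply (is_RInt_minus (V := C_R_NormedModule));
         [apply is_RInt_gamma_kernel|apply is_RInt_euler_pow, Hn0].
      + intros u [_ Hu]; unfold gamma_kernel.
        match goal with |- Cmod (?x * ?e - ?y * _)%C <= _ =>
          replace (x * e - y * e)%C with ((x - y) * e)%C by ring end.
        rewrite <- RtoC_minus, Cmod_mult, Cmod_R, Cmod_Cexp, Re_mult_RtoC.
        (* The comparison with Euler's power is available because t = e^u stays at most n up to the
           endpoint ln n. *)
        assert (Hen : exp u <= INR n) by (rewrite <- (exp_ln (INR n) Pn); apply exp_monotone, Hu).
        generalize (exp_pos u) (exp_pos (- exp u)) (exp_pos (Re z * u)); intros P1 P2 P3.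
        apply Rle_trans with (exp u ^ 2 * exp (- exp u) / INR n * exp (Re z * u)).
        * apply Rmult_le_compat_r; [lra|]; apply exp_minus_euler_pow; [exact Hn0|lra].
        * replace (K / INR n * (exp (Re z * u) / (1 + exp (Re z * u)) ^ 2)) with
            (/ INR n * (K * (exp (Re z * u) / (1 + exp (Re z * u)) ^ 2))) by (field; lra).
          replace (exp u ^ 2 * exp (- exp u) / INR n * exp (Re z * u)) with
            (/ INR n * (exp u ^ 2 * exp (- exp u) * exp (Re z * u))) by (field; lra).
          apply Rmult_le_compat_l; [left; apply Rinv_0_lt_compat, Pn|].
          eapply Rle_trans; [|apply Hle].
          apply Rmult_le_compat_r; [lra|]; apply Rmult_le_compat_r; lra.
      + intros u; apply (is_derive_scal (logistic (Re z))), is_derive_logistic, Hz.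
      + intros u; apply (ex_derive_continuous (V := R_NormedModule)).
        generalize (exp_pos (Re z * u)); intros; auto_derive; repeat split; nra.
    - rewrite <- Rmult_minus_distr_l.
      replace (K / Re z / INR n) with (K / INR n * / Re z) by (field; lra).
      apply Rmult_le_compat_l; [left; apply Rdiv_lt_0_compat; lra|].
      apply logistic_bounds, Hz. }
  replace (euler_seq z n - I)%C with ((J - I) + (- (J - W) + - (W - euler_seq z n)))%C by ring.
  eapply Rle_lt_trans; [apply Cmod_triangle|].
  eapply Rle_lt_trans; [apply Rplus_le_compat_l, Cmod_triangle|].
  rewrite !Cmod_opp; lra.
Qed.

(** * The p-k Gamma function *)

(** Each factor is xp/k + mp = p (x/k + m). *)
Lemma pk_poch_rising (p k : R) (x : C) (n : nat) :
  pk_poch p k x n = (RtoC (p ^ n) * rising (x / RtoC k) n)%C.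
Proof.
  induction n as [|n IH]; simpl; [ring|].
  rewrite IH, !RtoC_mult; unfold Cdiv; ring.
Qed.

Lemma RCpower_mult_base (c d : R) (z : C) : 0 < c -> 0 < d ->
  RCpower (c * d) z = (RCpower c z * RCpower d z)%C.
Proof.
  intros Hc Hd; unfold RCpower; rewrite <- Cexp_add, ln_mult, RtoC_plus by assumption.
  f_equal; ring.
Qed.

Lemma RtoC_neq_0 (r : R) : r <> 0 -> RtoC r <> RtoC 0.
Proof. intros H E; apply H; injection E; auto. Qed.

(** The n + 1 factors p of the Pochhammer symbol cancel p^(n+1), and (np)^z splits as n^z p^z since
    n > 0. *)
Lemma pk_Gamma_seq1_euler (p k : R) (x : C) (n : nat) : 0 < p -> (0 < n)%nat ->
  0 < Re (x / RtoC k) ->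
  pk_Gamma_seq1 p k x n = (RCpower p (x / RtoC k) * euler_seq (x / RtoC k) n)%C.
Proof.
  intros Hp Hn Hz; unfold pk_Gamma_seq1, euler_seq.
  rewrite pk_poch_rising, RCpower_mult_base, RtoC_mult by (auto; apply lt_0_INR, Hn).
  replace (n + 1)%nat with (S n) by lia; unfold RCpower at 1.
  field; split; [apply rising_neq_0, Hz|apply RtoC_neq_0, pow_nonzero; lra].
Qed.

(** Compared with the first expression, the second drops the denominator factor p (z + n) and one
    numerator factor np, where z = x/k. The ratio is (z + n)/n, which tends to 1. *)
Lemma pk_Gamma_seq2_seq1 (p k : R) (x : C) (n : nat) : 0 < p -> (0 < n)%nat ->
  0 < Re (x / RtoC k) ->
  pk_Gamma_seq2 p k x n =
    (pk_Gamma_seq1 p k x n * (x / RtoC k * RtoC (/ INR n) + RtoC 1))%C.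
Proof.
  intros Hp Hn Hz; unfold pk_Gamma_seq1, pk_Gamma_seq2.
  assert (Pn : 0 < INR n) by (apply lt_0_INR, Hn).
  rewrite !pk_poch_rising; replace (n + 1)%nat with (S n) by lia.
  set (z := (x / RtoC k)%C) in *; fold z.
  assert (E : RCpower (INR n * p) z = (RCpower (INR n * p) (z - RtoC 1) * RtoC (INR n * p))%C).
  { unfold RCpower.
    rewrite <- (exp_ln (INR n * p)) at 3 by (apply Rmult_lt_0_compat; lra).
    rewrite <- Cexp_real, <- Cexp_add; f_equal; ring. }
  rewrite E, RtoC_inv by lra.
  assert (Hr : rising z (S n) <> RtoC 0) by (apply rising_neq_0, Hz).
  simpl rising in *.
  assert (z + RtoC (INR n) <> RtoC 0)%C by (intros Q; apply Hr; rewrite Q; ring).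
  simpl pow; rewrite !RtoC_mult.
  field; repeat split; try (apply RtoC_neq_0; try apply pow_nonzero; lra); auto.
  apply rising_neq_0, Hz.
Qed.

Lemma pk_Gamma_seq1_lim (p k : R) (x I : C) : 0 < p -> 0 < Re (x / RtoC k) ->
  filterlim (euler_seq (x / RtoC k)) eventually (locally I) ->
  filterlim (pk_Gamma_seq1 p k x) eventually (locally (RCpower p (x / RtoC k) * I)%C).
Proof.
  intros Hp Hz HI.
  eapply filterlim_ext_loc; [|apply (filterlim_Cmult eventually);
    [apply (filterlim_const (RCpower p (x / RtoC k)))|exact HI]].
  exists 1%nat; intros n Hn; symmetry; apply pk_Gamma_seq1_euler; auto.
Qed.

Lemma pk_Gamma_seq2_lim (p k : R) (x L : C) : 0 < p -> 0 < Re (x / RtoC k) ->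
  filterlim (pk_Gamma_seq1 p k x) eventually (locally L) ->
  filterlim (pk_Gamma_seq2 p k x) eventually (locally L).
Proof.
  intros Hp Hz HL.
  assert (H : filterlim (fun n => x / RtoC k * RtoC (/ INR n) + RtoC 1)%C eventually
    (locally (RtoC 1))).
  { apply (filterlim_Cmod eventually); intros eps He.
    destruct (INR_unbounded (Cmod (x / RtoC k) / eps)) as [N HN].
    exists (S N); intros n Hn.
    assert (Pn : 0 < INR n) by (apply lt_0_INR; lia).
    assert (HNn : Cmod (x / RtoC k) / eps < INR n)
      by (eapply Rlt_trans; [exact HN|apply lt_INR; lia]).
    replace (x / RtoC k * RtoC (/ INR n) + RtoC 1 - RtoC 1)%C
      with (x / RtoC k * RtoC (/ INR n))%C by ring.
    rewrite Cmod_mult, Cmod_R, Rabs_pos_eq by (left; apply Rinv_0_lt_compat, Pn).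
    apply Rmult_lt_reg_r with (INR n / eps); [apply Rdiv_lt_0_compat; lra|].
    replace (eps * (INR n / eps)) with (INR n) by (field; lra).
    replace (Cmod (x / RtoC k) * / INR n * (INR n / eps)) with (Cmod (x / RtoC k) / eps)
      by (field; lra).
    exact HNn. }
  rewrite <- (Cmult_1_r L).
  eapply filterlim_ext_loc; [|apply (filterlim_Cmult eventually); [exact HL|exact H]].
  exists 1%nat; intros n Hn; symmetry; apply pk_Gamma_seq2_seq1; auto.
Qed.

(* The substitution [u = ln c + k ln t] absorbs both [c] and [k]. *)
Lemma is_RInt_pk_integrand (k c : R) (x : C) (s t : R) : 0 < k -> 0 < c -> 0 < s -> 0 < t ->
  @is_RInt C_R_NormedModule
    (fun u => (RtoC (exp (- (c * Rpower u k))) * RCpower u (x - RtoC 1))%C) s t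
    (RtoC (/ k) * RCpower (/ c) (x / RtoC k) *
     @RInt C_R_CompleteNormedModule (gamma_kernel (x / RtoC k))
       (ln c + k * ln s) (ln c + k * ln t))%C.
Proof.
  intros Hk Hc Hs Ht.
  assert (Hpos : forall u, Rmin s t <= u <= Rmax s t -> 0 < u).
  { intros u [Hu _]; eapply Rlt_le_trans; [|exact Hu]; apply Rmin_glb_lt; assumption. }
  assert (H := @is_RInt_comp C_R_CompleteNormedModule (gamma_kernel (x / RtoC k))
    (fun u => ln c + k * ln u) (fun u => k / u) s t).
  apply (is_RInt_Cmult_l (RtoC (/ k) * RCpower (/ c) (x / RtoC k))%C) in H.
  - refine (is_RInt_ext _ _ _ _ _ _ H); intros u Hu.
    assert (Pu : 0 < u) by (apply Hpos; lra).
    match goal with |- ?l = ?r => change (@eq C l r) end.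
    rewrite scal_C; unfold gamma_kernel, RCpower.
    assert (E : exp (ln c + k * ln u) = c * Rpower u k)
      by (unfold Rpower; rewrite exp_plus, exp_ln; auto).
    rewrite E, ln_Rinv by exact Hc.
    replace (x / RtoC k * RtoC (ln c + k * ln u))%C
      with (x / RtoC k * RtoC (ln c) + (x - RtoC 1) * RtoC (ln u) + RtoC (ln u))%C.
    + rewrite !Cexp_add, Cexp_real, exp_ln by exact Pu.
      (* The powers c^(-z) and c^z cancel, and the Jacobian k/u cancels 1/k together with the extra
         u in u^x = u^(x-1) u. *)
      transitivity ((RtoC (/ k) * RtoC (k / u) * RtoC u) *
        (Cexp (x / RtoC k * RtoC (- ln c)) * Cexp (x / RtoC k * RtoC (ln c))) *
        (RtoC (exp (- (c * Rpower u k))) * Cexp ((x - RtoC 1) * RtoC (ln u))))%C; [ring|].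
      rewrite <- Cexp_add, <- !RtoC_mult.
      replace (x / RtoC k * RtoC (- ln c) + x / RtoC k * RtoC (ln c))%C with (RtoC 0)
        by (rewrite RtoC_opp; ring).
      replace (/ k * (k / u) * u) with 1 by (field; lra).
      rewrite Cexp_0; ring.
    + rewrite RtoC_plus, RtoC_mult; field; apply RtoC_neq_0; lra.
  - intros u _; apply continuous_gamma_kernel.
  - intros u Hu; assert (Pu := Hpos u Hu); split.
    + auto_derive; [exact Pu|field; lra].
    + apply (ex_derive_continuous (V := R_NormedModule)); auto_derive; lra.
Qed.

(** The map t -> ln c + k ln t sends the ends 0+ and plus infinity to minus and plus infinity, so
    the limit over the line transfers. *)
Lemma is_RInt_gen_pk_integrand (k c : R) (x I : C) : 0 < k -> 0 < c ->
  filterlim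
    (fun ab => @RInt C_R_CompleteNormedModule (gamma_kernel (x / RtoC k)) (fst ab) (snd ab))
    (filter_prod (Rbar_locally m_infty) (Rbar_locally p_infty)) (locally I) ->
  @is_RInt_gen C_R_NormedModule
    (fun u => (RtoC (exp (- (c * Rpower u k))) * RCpower u (x - RtoC 1))%C)
    (at_right 0) (Rbar_locally p_infty) (RtoC (/ k) * RCpower (/ c) (x / RtoC k) * I)%C.
Proof.
  intros Hk Hc HI.
  assert (Hm : filterlim (fun s => ln c + k * ln s) (at_right 0) (Rbar_locally m_infty)).
  { apply (filterlim_comp _ _ _ ln (fun v => ln c + k * v) _ (Rbar_locally m_infty));
      [exact is_lim_ln_0|].
    intros P [M HM]; exists ((M - ln c) / k); intros v Hv; apply HM.
    apply (Rmult_lt_compat_l k) in Hv; [|exact Hk].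
    replace (k * ((M - ln c) / k)) with (M - ln c) in Hv by (field; lra); lra. }
  assert (Hp : filterlim (fun s => ln c + k * ln s) (Rbar_locally p_infty) (Rbar_locally p_infty)).
  { apply (filterlim_comp _ _ _ ln (fun v => ln c + k * v) _ (Rbar_locally p_infty));
      [exact is_lim_ln_p|].
    intros P [M HM]; exists ((M - ln c) / k); intros v Hv; apply HM.
    apply (Rmult_lt_compat_l k) in Hv; [|exact Hk].
    replace (k * ((M - ln c) / k)) with (M - ln c) in Hv by (field; lra); lra. }
  assert (HL : filterlim (fun ab => (RtoC (/ k) * RCpower (/ c) (x / RtoC k) *
      @RInt C_R_CompleteNormedModule (gamma_kernel (x / RtoC k))
        (ln c + k * ln (fst ab)) (ln c + k * ln (snd ab)))%C)
     (filter_prod (at_right 0) (Rbar_locally p_infty))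
     (locally (RtoC (/ k) * RCpower (/ c) (x / RtoC k) * I)%C)).
  { apply filterlim_Cmult; [typeclasses eauto|apply filterlim_const|].
    refine (filterlim_comp_2 (fun ab => ln c + k * ln (fst ab)) (fun ab => ln c + k * ln (snd ab))
      (fun a b => @RInt C_R_CompleteNormedModule (gamma_kernel (x / RtoC k)) a b) _ _ HI).
    - refine (filterlim_comp _ _ _ fst (fun s => ln c + k * ln s) _ _ _ _ Hm); apply filterlim_fst.
    - refine (filterlim_comp _ _ _ snd (fun s => ln c + k * ln s) _ _ _ _ Hp); apply filterlim_snd. }
  (* The substitution formula requires positive endpoints, which holds eventually along both
     filters. *)
  assert (HP : filter_prod (at_right 0) (Rbar_locally p_infty)
    (fun ab : R * R => 0 < fst ab /\ 0 < snd ab)).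
  { exists (fun s => 0 < s) (fun t => 0 < t).
    - exists (mkposreal 1 Rlt_0_1); intros y _ Hy; exact Hy.
    - exists 0; intros y Hy; exact Hy.
    - intros s t Hs Ht; split; assumption. }
  intros P HPl; specialize (HL P HPl); unfold filtermap in HL; unfold filtermapi.
  generalize (filter_and _ _ HP HL); apply filter_imp.
  intros [s t] [[Hs Ht] HPst]; eexists; split; [|exact HPst].
  apply is_RInt_pk_integrand; assumption.
Qed.

Theorem theorem2p7 (k p a : R) (hk : 0 < k) (hp : 0 < p) (ha : 0 < a)
    (x : C) (hxk : forall m : Z, (m < 0)%Z -> x <> RtoC (k * IZR m))
    (hx : 0 < Re x) :
  let f : R -> C := fun t : R =>
    (RtoC (exp (- (Rpower t k / p) * a)) * RCpower t (x - RtoC 1))%C in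
  is_pk_Gamma p k x (pk_Gamma p k x) /\
  ex_CRInt_0_infty f /\
  pk_Gamma p k x = (RCpower a (x / RtoC k) * CRInt_0_infty f)%C.
Proof.
  intros f.
  assert (hz : 0 < Re (x / RtoC k)).
  { unfold Cdiv; rewrite <- RtoC_inv by lra; rewrite Re_mult_RtoC.
    apply Rmult_lt_0_compat; [exact hx|apply Rinv_0_lt_compat, hk]. }
  destruct (gamma_kernel_converges _ hz) as [I HI].
  set (L := (RCpower p (x / RtoC k) * I)%C).
  assert (H1 : filterlim (pk_Gamma_seq1 p k x) eventually (locally L))
    by (apply pk_Gamma_seq1_lim; auto; apply euler_limit; auto).
  assert (HG : is_pk_Gamma p k x (RtoC (1 / k) * L)%C)
    by (exists L; repeat split; auto; apply pk_Gamma_seq2_lim; auto).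
  assert (EG : pk_Gamma p k x = (RtoC (1 / k) * L)%C).
  (* Uniqueness of the limit of the first sequence forces any other candidate to equal this one. *)
  { apply (@iota_unique _ C_R_CompleteNormedModule); [|exact HG].
    intros g [L' [H1' [_ ->]]]; do 2 f_equal.
    exact (@filterlim_locally_unique nat R_AbsRing C_R_NormedModule eventually _
      (pk_Gamma_seq1 p k x) L' L H1' H1). }
  (* The substitution is applied with c = a/p. *)
  assert (HF : @is_RInt_gen C_R_NormedModule f (at_right 0) (Rbar_locally p_infty)
    (RtoC (/ k) * RCpower (/ (a / p)) (x / RtoC k) * I)%C).
  { eapply is_RInt_gen_ext; [|apply is_RInt_gen_pk_integrand with (3 := HI);
      [exact hk|apply Rdiv_lt_0_compat; assumption]].
    apply filter_forall; intros [s t] u _; unfold f.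
    do 3 f_equal; field; lra. }
  split; [rewrite EG; exact HG|split].
  - eexists; exact HF.
  - rewrite EG; unfold CRInt_0_infty.
    rewrite (@is_RInt_gen_unique C_R_CompleteNormedModule _ _ _ _ f _ HF).
    (* The power (p/a)^z splits into p^z a^(-z); the prefactor a^z then cancels a^(-z), leaving p^z
       I / k. *)
    replace (/ (a / p)) with (p * / a) by (field; lra).
    rewrite RCpower_mult_base by (auto; apply Rinv_0_lt_compat, ha).
    unfold L; replace (1 / k) with (/ k) by (field; lra).
    assert (E : (RCpower a (x / RtoC k) * RCpower (/ a) (x / RtoC k))%C = RtoC 1).
    { rewrite <- RCpower_mult_base by (auto; apply Rinv_0_lt_compat, ha).
      rewrite Rinv_r by lra; unfold RCpower; rewrite ln_1, Cmult_0_r; apply Cexp_0. }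
    transitivity (RtoC (/ k) * RCpower p (x / RtoC k) * I *
      (RCpower a (x / RtoC k) * RCpower (/ a) (x / RtoC k)))%C; [rewrite E|]; ring.
Qed.
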